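(* For all positive integers $k$, $\textnormal{mc}(k)=\textnormal{ek}(k)$, where $\textnormal{mc}(k)$ is the maximum clique number of a graph with edge metric dimension at most $k$, and $\textnormal{ek}(k)$ is the maximum size of a family $\mathcal{F}$ of subsets of $\{1,2,\dots,k\}$ such that all pairwise unions are distinct, i.e., $A\cup B\ne C\cup D$ whenever $\{A,B\}\ne\{C,D\}$ are two different unordered pairs of distinct members of $\mathcal{F}$.
   Context: Graphs are finite, simple, undirected. For an edge $e=\{u,v\}$ and vertex $w$, $\textnormal{dist}(e,w)=\min(\textnormal{dist}(w,u),\textnormal{dist}(w,v))$. A set $S=\{v_1,\dots,v_k\}$ of vertices is an edge resolving set of $G$ if the vectors $(\textnormal{dist}(e,v_1),\dots,\textnormal{dist}(e,v_k))$ are pairwise distinct over all edges $e$; the edge metric dimension $\textnormal{edim}(G)$ is the minimum size of an edge resolving set. *)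

(* Defs.v *)
From mathcomp Require Import all_boot.

Set Implicit Arguments.
Unset Strict Implicit.
Unset Printing Implicit Defensive.

Record graph := Graph {
  vertex :> finType;
  adj : rel vertex;
  adj_sym : symmetric adj;
  adj_irr : irreflexive adj
}.

(* A finite distance is at most #|G|.-1; the value #|G| stands for the
   infinite distance between vertices in different components. *)
Definition dist (G : graph) (x y : G) : nat :=
  \big[minn/#|G|]_(n < #|G| |
      [exists p : n.-tuple G, path (@adj G) x p && (last x p == y)]) n.

Definition edges (G : graph) : {set {set G}} :=
  [set [set u; v] | u in G, v in adj u].

Definition edist (G : graph) (e : {set G}) (w : G) : nat :=
  \big[minn/#|G|]_(u in e) dist w u.

Definition edge_resolving (G : graph) (S : {set G}) : bool :=
  [forall e in edges G, forall f in edges G,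
     [forall w in S, edist e w == edist f w] ==> (e == f)].

(* The default value #|G| of the minimum is the size of the set of all
   vertices, which is always edge resolving: e contains exactly the vertices
   at distance 0 from e. *)
Definition edim (G : graph) : nat :=
  \big[minn/#|G|]_(S : {set G} | edge_resolving S) #|S|.

Definition clique (G : graph) (K : {set G}) : bool :=
  [forall x in K, forall y in K, (x != y) ==> adj x y].

Definition clique_number (G : graph) : nat :=
  \max_(K : {set G} | clique K) #|K|.

Definition is_maximum (P : nat -> Prop) (m : nat) : Prop :=
  P m /\ forall n, P n -> n <= m.

(* "mc(k) exists and equals m": the maximum ranges over all finite graphs, so
   its existence is part of the assertion. *)
Definition is_mc (k m : nat) : Prop :=
  is_maximum (fun n => exists2 G : graph, edim G <= k & clique_number G = n) m.

Definition distinct_unions (k : nat) (F : {set {set 'I_k}}) : bool :=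
  [forall A in F, forall B in F, forall C in F, forall D in F,
     [&& A != B, C != D & [set A; B] != [set C; D]]
       ==> (A :|: B != C :|: D)].

Definition ek (k : nat) : nat :=
  \max_(F : {set {set 'I_k}} | distinct_unions F) #|F|.

(* Main.v *)
Require Import Defs.
From mathcomp Require Import all_boot.

(** Seen from a landmark [w], the vertices of a clique are at distance [m] or
    [m + 1] for some [m]; sending each clique vertex [x] to the set of landmarks
    for which [x] is at the smaller distance turns the vector of distances of
    the edge [xy] into the union of the sets of [x] and [y]. Conversely, a
    family [F] gives the graph consisting of a clique on [F] and of [k] further
    independent vertices [i], where [i] is joined to [A] when [i \in A]; these
    [k] vertices resolve all edges, and for this it is enough to look at whether
    a distance is 0, 1 or larger. *)

Set Implicit Arguments.
Unset Strict Implicit.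
Unset Printing Implicit Defensive.

(** * Minima with a default value, distances and edge resolving sets *)

Lemma bigmin_leq (I : finType) (P : pred I) (f : I -> nat) (N n : nat) :
  n < N ->
  (\big[minn/N]_(i | P i) f i <= n) = [exists (i | P i), f i <= n].
Proof.
move=> ltnN; rewrite -big_orE.
apply: (big_morph (fun m => m <= n)) => [a b|]; first exact: geq_min.
by rewrite leqNgt ltnN.
Qed.

Lemma bigmin_leq_id (I : finType) (P : pred I) (f : I -> nat) (N : nat) :
  \big[minn/N]_(i | P i) f i <= N.
Proof.
elim/big_rec: _ => // i m _ lemN.
by rewrite geq_min lemN orbT.
Qed.

Section Distance.
Variable G : graph.
Implicit Types (x y u v w : G) (e : {set G}).

(** As [n] is below the default [#|G|], only a genuine walk can bring the minimum down to [n]. *)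
Lemma dist_leqP n x y : n < #|G| ->
  reflect (exists p, [/\ size p <= n, path (@adj G) x p & last x p = y])
          (dist x y <= n).
Proof.
move=> ltn; rewrite /dist bigmin_leq //.
apply: (iffP exists_inP) => [[i /existsP[p /andP[pp /eqP lp]] lein]|].
  by exists p; rewrite size_tuple.
case=> p [sp pp lp].
exists (Ordinal (leq_ltn_trans sp ltn)) => //.
by apply/existsP; exists (in_tuple p); rewrite pp lp eqxx.
Qed.

Lemma card_graph_gt0 x : 0 < #|G|.
Proof. by apply/card_gt0P; exists x. Qed.

Lemma dist_leq0 x y : (dist x y <= 0) = (x == y).
Proof.
apply/(dist_leqP _ _ (card_graph_gt0 x))/eqP => [[p [sp _ <-]]|<-].
  by case: p sp.
by exists [::].
Qed.

Lemma dist_leq1 x y : 1 < #|G| -> (dist x y <= 1) = (x == y) || adj x y.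
Proof.
move=> G1; apply/(dist_leqP _ _ G1)/orP.
  case=> [[|z [|? ?]] [//= _ + lp]]; first by left; apply/eqP.
  by rewrite andbT -lp; right.
case=> [/eqP <-|xy]; first by exists [::].
by exists [:: y]; split=> //=; rewrite xy.
Qed.

Lemma dist_adj w x y : adj x y -> dist w y <= (dist w x).+1.
Proof.
(* Once [(dist w x).+1] reaches [#|G|], the default bounds [dist w y]; below it, a shortest walk to
   [x] is prolonged by [y]. *)
move=> xy; have [ltG|geG] := ltnP (dist w x).+1 #|G|; last first.
  exact: leq_trans (bigmin_leq_id _ _ _) geG.
have /(dist_leqP _ _ (ltnW ltG))[p [sp pp lp]] := leqnn (dist w x).
apply/(dist_leqP _ _ ltG); exists (rcons p y).
by rewrite size_rcons rcons_path last_rcons pp lp xy.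
Qed.

Lemma edist_leq n e w : n < #|G| ->
  (edist e w <= n) = [exists u in e, dist w u <= n].
Proof. exact: bigmin_leq. Qed.

Lemma edist_leq0 e w : (edist e w <= 0) = (w \in e).
Proof.
rewrite edist_leq ?(card_graph_gt0 w) //.
apply/exists_inP/idP => [[u ue]|we]; last by exists w; rewrite ?dist_leq0.
by rewrite dist_leq0 => /eqP ->.
Qed.

Lemma edist_set2 x y w : edist [set x; y] w = minn (dist w x) (dist w y).
Proof.
(* Both sides are at most [#|G|], so passing the same thresholds below [#|G|] makes them equal. *)
have le1 n : n < #|G| ->
    (edist [set x; y] w <= n) = (minn (dist w x) (dist w y) <= n).
  move=> ltn; rewrite edist_leq // geq_min; apply/exists_inP/orP.
    by case=> u /set2P[]->; [left|right].
  by case=> le; [exists x|exists y]; rewrite ?set21 ?set22.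
have leG : minn (dist w x) (dist w y) <= #|G|.
  by rewrite geq_min bigmin_leq_id.
have [lt|lt|//] := ltngtP (edist [set x; y] w) (minn (dist w x) (dist w y)).
  by have := le1 _ (leq_trans lt leG); rewrite leqnn leqNgt lt.
have := le1 _ (leq_trans lt (bigmin_leq_id _ _ _)).
by rewrite leqnn leqNgt lt.
Qed.

Lemma edgesP e :
  reflect (exists u v, adj u v /\ e = [set u; v]) (e \in edges G).
Proof.
apply: (iffP imset2P) => [[u v _ uv ->]|[u [v [uv ->]]]].
  by exists u, v.
by exists u v.
Qed.

Lemma edge_resolvingP (S : {set G}) :
  reflect {in edges G &, forall e f,
             {in S, forall w, edist e w = edist f w} -> e = f}
          (edge_resolving S).
Proof.
apply: (iffP forall_inP) => [rS e f eG fG ef|rS e eG].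
  apply/eqP; move/(_ e eG)/forall_inP/(_ f fG)/implyP: rS; apply.
  by apply/forall_inP => w wS; rewrite ef.
apply/forall_inP => f fG; apply/implyP => /forall_inP ef.
by apply/eqP/rS => // w /ef/eqP.
Qed.

Lemma edge_resolvingT : edge_resolving [set: G].
Proof.
apply/edge_resolvingP => e f _ _ ef; apply/setP => w.
by rewrite -!edist_leq0 ef.
Qed.

Lemma edim_leqP k :
  reflect (exists2 S : {set G}, edge_resolving S & #|S| <= k) (edim G <= k).
Proof.
(* For [#|G| <= k] both sides hold, the right one by the set of all vertices. *)
have [ltkG|geG] := ltnP k #|G|.
  by rewrite /edim bigmin_leq //; apply: exists_inP.
apply: (iffP idP) => _; last exact: leq_trans (bigmin_leq_id _ _ _) geG.
by exists [set: G]; rewrite ?edge_resolvingT ?cardsT.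
Qed.

End Distance.

(** * Upper bound: from cliques to families with distinct unions *)

Lemma distinct_unionsP (k : nat) (F : {set {set 'I_k}}) :
  reflect (forall A B C D, A \in F -> B \in F -> C \in F -> D \in F ->
             A != B -> C != D -> A :|: B = C :|: D ->
             [set A; B] = [set C; D])
          (distinct_unions F).
Proof.
apply: (iffP forall_inP) => [duF A B C D AF BF CF DF AB CD|duF A AF].
  move=> eqU; apply/eqP; apply: contra_eqT eqU => neq.
  move/(_ A AF)/forall_inP/(_ B BF)/forall_inP/(_ C CF): duF.
  by move/forall_inP/(_ D DF)/implyP; apply; rewrite AB CD.
apply/forall_inP => B BF; apply/forall_inP => C CF; apply/forall_inP => D DF.
apply/implyP => /and3P[AB CD]; apply: contra_neq; exact: duF.
Qed.

(** A family of two sets has a single unordered pair, so no two unions can clash. This settles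
    cliques of at most two vertices. *)
Lemma ek_geq2 (k : nat) : 0 < k -> 2 <= ek k.
Proof.
move=> k0; have neq : (set0 : {set 'I_k}) != setT.
  by rewrite eq_sym -card_gt0 cardsT card_ord.
have -> : 2 = #|[set set0; [set: 'I_k]]| by rewrite cards2 neq.
apply: leq_bigmax_cond; apply/distinct_unionsP.
have pairE A B : A \in [set set0; [set: 'I_k]] -> B \in [set set0; setT] ->
    A != B -> [set A; B] = [set set0; setT].
  by rewrite !inE => /orP[]/eqP-> /orP[]/eqP->; rewrite ?eqxx // setUC.
by move=> A B C D AF BF CF DF AB CD _; rewrite !pairE.
Qed.

Lemma clique_leq_ek (k : nat) (G : graph) (K : {set G}) :
  0 < k -> edim G <= k -> clique K -> #|K| <= ek k.
Proof.
move=> k0 /edim_leqP[S rS Sk] cK.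
have [K2|K3] := leqP #|K| 2; first exact: leq_trans K2 (ek_geq2 k0).
have /card_gt0P[x0 x0K] : 0 < #|K| by exact: ltn_trans K3.
have adjK x y : x \in K -> y \in K -> x != y -> adj x y.
  by move=> xK yK; move/forall_inP/(_ x xK)/forall_inP/(_ y yK)/implyP: cK.
(* If [#|S| < k], the remaining indices all denote the vertex [x0]: extra
   landmarks do no harm. *)
pose W (i : 'I_k) := nth x0 (enum S) i.
pose near x := [set i | [forall y in K, dist (W i) x <= dist (W i) y]].
have edistE i : exists m, {in K &, forall x y,
    edist [set x; y] (W i) = m + (i \notin near x :|: near y)}.
  (* The offset [m] is the distance to a clique vertex [a] nearest to [W i]; the other clique
     vertices are adjacent to [a], hence at most one step further. *)
  case: (arg_minnP (dist (W i)) x0K) => a aK mina.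
  exists (dist (W i) a).
  have distE x : x \in K -> dist (W i) x = dist (W i) a + (i \notin near x).
    move=> xK; rewrite inE.
    case: forall_inP => [le|nle]; rewrite ?addn0 ?addn1; apply/eqP.
      by rewrite eqn_leq le // mina.
    have lt : dist (W i) a < dist (W i) x.
      by rewrite ltnNge; apply/negP => le; apply: nle => y /mina/(leq_trans le).
    rewrite eqn_leq lt dist_adj // adjK //.
    by apply: contraTneq lt => ->; rewrite ltnn.
  move=> x y xK yK.
  rewrite edist_set2 (distE x) // (distE y) // in_setU negb_or.
  (* The smaller of two 0/1 offsets is 1 only if [i] lies in neither set. *)
  by rewrite -addn_minr; do 2!case: (_ \in _).
have union_inj x y z t : x \in K -> y \in K -> z \in K -> t \in K ->
    x != y -> z != t -> near x :|: near y = near z :|: near t ->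
    [set x; y] = [set z; t].
  move=> xK yK zK tK xy zt eqU.
  apply: (edge_resolvingP S rS); try by
    apply/edgesP; eexists _, _; split; last reflexivity; apply: adjK.
  move=> w wS.
  have ltk : index w (enum S) < k.
    by apply: leq_trans Sk; rewrite cardE index_mem mem_enum.
  have <- : W (Ordinal ltk) = w by rewrite /W nth_index ?mem_enum.
  by case: (edistE (Ordinal ltk)) => m Em; rewrite !Em // eqU.
(* If [near x = near y], a third clique vertex [z] gives edges [zx] and [zy] with the same union, so
   they coincide and [x = y]. *)
have near_inj : {in K &, injective near}.
  move=> x y xK yK eqN; apply/eqP/negPn/negP => xy.
  have /card_gt0P[z] : 0 < #|K :\: [set x; y]|.
    rewrite cardsD subn_gt0; apply: leq_ltn_trans K3.
    apply: leq_trans (subset_leq_card (subsetIr _ _)) _.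
    by rewrite cards2; case: eqP.
  rewrite !inE negb_or => /andP[/andP[zx zy] zK].
  have /setP/(_ x) := union_inj z x z y zK xK zK yK zx zy (congr1 _ eqN).
  by rewrite !inE eqxx orbT eq_sym (negPf zx) (negPf xy).
rewrite -(card_in_imset near_inj).
apply: leq_bigmax_cond; apply/distinct_unionsP.
move=> _ _ _ _ /imsetP[x xK ->] /imsetP[y yK ->]
  /imsetP[z zK ->] /imsetP[t tK ->] xy zt eqU.
have := union_inj x y z t xK yK zK tK
  (contra_neq (@congr1 _ _ near x y) xy) (contra_neq (@congr1 _ _ near z t) zt)
  eqU.
by move/(congr1 (fun e : {set G} => near @: e)); rewrite !imsetU1 !imset_set1.
Qed.

(** * Lower bound: the graph of a family with distinct unions *)

Section UnionGraph.
Variables (k : nat) (F : {set {set 'I_k}}).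

(* Sets outside [F] are kept as isolated vertices. *)
Definition union_adj (x y : 'I_k + {set 'I_k}) : bool :=
  match x, y with
  | inl _, inl _ => false
  | inl i, inr A | inr A, inl i => (A \in F) && (i \in A)
  | inr A, inr B => [&& A \in F, B \in F & A != B]
  end.

Lemma union_adj_sym : symmetric union_adj.
Proof. by move=> [i|A] [j|B] //=; rewrite eq_sym andbCA. Qed.

Lemma union_adj_irr : irreflexive union_adj.
Proof. by move=> [i|A] //=; rewrite eqxx !andbF. Qed.

Definition union_graph : graph := Graph union_adj_sym union_adj_irr.

Lemma union_edgeP (e : {set union_graph}) : e \in edges union_graph ->
  (exists i A, [/\ A \in F, i \in A & e = [set inl i; inr A]]) \/
  (exists A B, [/\ A \in F, B \in F, A != B & e = [set inr A; inr B]]).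
Proof.
case/edgesP=> [[i|A] [[j|B] [//= + ->]]].
- by case/andP=> BF iB; left; exists i, B.
- by case/andP=> AF jA; left; exists j, A; rewrite setUC.
- by case/and3P=> AF BF AB; right; exists A, B.
Qed.

Hypotheses (k0 : 0 < k) (duF : distinct_unions F).

(** Keeps the default distance above 1, so that the threshold 1 detects adjacency. *)
Lemma card_union_graph_gt1 : 1 < #|union_graph|.
Proof. by apply/card_gt1P; exists (inl (Ordinal k0)), (inr set0). Qed.

Definition landmarks : {set union_graph} := [set inl i | i : 'I_k].

Lemma edist_leq1_set2 (w x y : union_graph) :
  (edist [set x; y] w <= 1) = [|| w == x, adj w x, w == y | adj w y].
Proof.
rewrite edist_leq ?card_union_graph_gt1 //; apply/exists_inP/idP.
  case=> u; rewrite !inE dist_leq1 ?card_union_graph_gt1 //.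
  by case/orP=> /eqP-> /orP[]->; rewrite ?orbT.
rewrite orbA => /orP[wx|wy]; [exists x|exists y];
  by rewrite ?inE ?eqxx ?orbT // dist_leq1 ?card_union_graph_gt1.
Qed.

(** Distance 0 tells which landmark, if any, lies on the edge. For an edge inside the clique, the
    landmarks at distance at most 1 form the union of its two sets. *)
Lemma landmarks_resolving : edge_resolving landmarks.
Proof.
apply/edge_resolvingP => e f eG fG ef.
have ef_i (i : 'I_k) :
    edist e (inl i : union_graph) = edist f (inl i : union_graph).
  by apply: ef; apply: imset_f.
have mem_ef (i : 'I_k) :
    ((inl i : union_graph) \in e) = ((inl i : union_graph) \in f).
  by rewrite -!edist_leq0 ef_i.
have near_ef (i : 'I_k) := congr1 (fun d => d <= 1) (ef_i i).
case: (union_edgeP eG) (union_edgeP fG) =>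
  [[i [A [AF iA eE]]]|[A [B [AF BF AB eE]]]]
  [[j [C [CF jC fE]]]|[C [D [CF DF CD fE]]]]; subst e f.
- have := mem_ef i; rewrite !inE eqxx /= orbF => /esym/eqP[ij].
  rewrite ij in iA near_ef *.
  (* A landmark [l] other than [j] is within distance 1 exactly when it lies in the set; [j] itself
     lies in both [A] and [C]. *)
  congr [set _; inr _]; apply/setP => l.
  have := near_ef l; rewrite /= !edist_leq1_set2 /= AF CF.
  by case: eqP => [[->]|_] //=; rewrite iA jC.
- by have := mem_ef i; rewrite !inE eqxx.
- by have := mem_ef j; rewrite !inE eqxx.
have eqU : A :|: B = C :|: D.
  apply/setP => l; have := near_ef l.
  by rewrite /= !edist_leq1_set2 /= AF BF CF DF !inE.
have := distinct_unionsP F duF A B C D AF BF CF DF AB CD eqU.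
move/(congr1 (fun H : {set {set 'I_k}} =>
  [set (inr E : union_graph) | E in H])).
by rewrite !imsetU1 !imset_set1.
Qed.

Lemma edim_union_graph : edim union_graph <= k.
Proof.
apply/edim_leqP; exists landmarks; first exact: landmarks_resolving.
by rewrite -[leqRHS]card_ord leq_imset_card.
Qed.

Lemma clique_number_union_graph : #|F| <= clique_number union_graph.
Proof.
pose K : {set union_graph} := [set inr A | A in F].
have -> : #|F| = #|K| by rewrite card_imset // => A B [].
apply: leq_bigmax_cond.
apply/forall_inP => _ /imsetP[A AF ->]; apply/forall_inP => _ /imsetP[B BF ->].
by apply/implyP => AB /=; rewrite AF BF; apply: contra_neq AB => ->.
Qed.

End UnionGraph.

Theorem theorem30 (k : nat) (hk : 0 < k) : is_mc k (ek k).
Proof.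
have le_ek (G : graph) : edim G <= k -> clique_number G <= ek k.
  by move=> Gk; apply/bigmax_leqP => K; apply: clique_leq_ek.
split=> [|_ [G Gk <-]]; last exact: le_ek.
(* The empty family qualifies, so the maximum [ek k] is attained by some [F]. *)
have du_gt0 : 0 < #|@distinct_unions k|.
  apply/card_gt0P; exists set0.
  by apply/distinct_unionsP => A B C D; rewrite inE.
have [F duF ekE] := eq_bigmax_cond (fun F : {set {set 'I_k}} => #|F|) du_gt0.
have Gk := edim_union_graph hk duF.
exists (union_graph F) => //; apply/eqP; rewrite eqn_leq le_ek //.
by rewrite /ek ekE clique_number_union_graph.
Qed.
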